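(* Let $E=\mathbb{Q}(\sqrt{-11})$, let $\omega=\frac{1+\sqrt{-11}}{2}$, and let $\mathfrak{O}=\mathbb{Z}[\omega]$ be the ring of integers of $E$. The Hermitian $\mathfrak{O}$-lattice $\langle 1,1\rangle\perp\begin{pmatrix}2&\omega\\\overline{\omega}&2\end{pmatrix}$ is $2$-universal.
   Context: A Hermitian $\mathfrak{O}$-lattice is a finitely generated $\mathfrak{O}$-submodule $L$ of a finite-dimensional $E$-vector space equipped with a form $H$ that is linear in the first variable, satisfies $H(x,y)=\overline{H(y,x)}$ (bar is complex conjugation), and has $H(L,L)\subseteq\mathfrak{O}$. Its rank is $\dim_E EL$; binary means rank 2. It is positive (definite) if $H(v):=H(v,v)>0$ for all $0\neq v\in L$. Here every lattice is free ($\mathfrak{O}$ is a PID); the Gram matrix of a lattice with basis $v_1,\dots,v_n$ is $M_L=(H(v_i,v_j))$, and a lattice is identified with its Gram matrix. $\langle a_1,\dots,a_n\rangle$ denotes the lattice with diagonal Gram matrix with entries $a_1,\dots,a_n$, and $\perp$ denotes orthogonal sum. $L$ represents $\ell$ if $M_\ell=XM_LX^*$ for some matrix $X$ over $\mathfrak{O}$, where $X^*$ is the conjugate transpose. A positive Hermitian $\mathfrak{O}$-lattice is $2$-universal if it represents all binary positive Hermitian $\mathfrak{O}$-lattices. *)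

(* Defs.v *)
(* Complex numbers are the algebraic ones, algC. *)
From HB Require Import structures.
From mathcomp Require Import all_boot all_order all_algebra all_field.
From mathcomp Require Import ring.
Set Implicit Arguments. Unset Strict Implicit. Unset Printing Implicit Defensive.
Import Order.TTheory GRing.Theory Num.Theory.
Local Open Scope ring_scope.
Local Open Scope sesquilinear_scope.

Definition omega : algC := (1 + sqrtC (- 11)) / 2.

Lemma omega_sqr : omega ^+ 2 = omega - 3.
Proof.
have s2 : sqrtC (- 11 : algC) ^+ 2 = - 11 by rewrite sqrtCK.
by rewrite /omega; field: s2; rewrite ?pnatr_eq0.
Qed.

(* Z[omega]: by omega_sqr, the Z-span of 1 and omega is closed under products. *)
Definition in_O (z : algC) : Prop := exists a b : int, z = a%:~R + b%:~R * omega.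

Definition mx_in_O m n (A : 'M[algC]_(m, n)) : Prop := forall i j, in_O (A i j).

(* H(x, y) in coordinates: linear in x, with Gram matrix M. *)
Definition herm_form n (M : 'M[algC]_n) (x y : 'rV[algC]_n) : algC :=
  (x *m M *m y ^t*) 0 0.

(* A free lattice of rank n with a chosen basis is given by its Gram matrix M:
   it is O^n, with the form herm_form M.  Integrality H(L, L) <= O amounts to
   the entries of M being in O. *)
Definition herm_lattice n (M : 'M[algC]_n) : Prop :=
  M \is hermsymmx /\ mx_in_O M.

(* In algC, 0 < z also says that z is real. *)
Definition positive_lattice n (M : 'M[algC]_n) : Prop :=
  herm_lattice M /\
  forall v : 'rV[algC]_n, mx_in_O v -> v != 0 -> 0 < herm_form M v v.

Definition represents m n (M : 'M[algC]_m) (N : 'M[algC]_n) : Prop :=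
  exists X : 'M[algC]_(n, m), mx_in_O X /\ N = X *m M *m X ^t*.

Definition two_universal m (M : 'M[algC]_m) : Prop :=
  positive_lattice M /\
  forall N : 'M[algC]_2, positive_lattice N -> represents M N.

Definition diag_lattice n (a : n.-tuple algC) : 'M[algC]_n :=
  diag_mx (\row_i tnth a i).

Definition orth_sum m n (M : 'M[algC]_m) (N : 'M[algC]_n) : 'M[algC]_(m + n) :=
  block_mx M 0 0 N.

Definition mx22 (a b c d : algC) : 'M[algC]_2 :=
  \matrix_(i, j) nth 0 (nth [::] [:: [:: a; b]; [:: c; d]] i) j.

(* Main.v *)
Require Import Defs.
From HB Require Import structures.
From mathcomp Require Import all_boot all_order all_algebra all_field.
From mathcomp Require Import ring lra zify.
Set Implicit Arguments. Unset Strict Implicit. Unset Printing Implicit Defensive.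
Import Order.TTheory GRing.Theory Num.Theory.
Local Open Scope ring_scope.

(** Write B for the lattice with Gram matrix (2, omega; conj omega, 2). It has
    determinant 1, so the quaternary lattice <1,1> + B is unimodular, and so are
    I_3 = <1,1,1> and B + <1>. The proof goes through ternary lattices.

    Every positive binary lattice N lies in a positive ternary lattice of
    determinant 1 (unimodular_ternary). If the determinant d of N is divisible
    by 11 or by the square of another prime, N has a proper integral
    overlattice, of smaller determinant (enlarge_11, enlarge_prime_sqr); so it
    may be assumed that d is squarefree and prime to 11. Then N is not zero
    modulo any prime p dividing d, and since the norm form of the ring of
    integers takes all values modulo p (nrm_surj), N represents -1 modulo p;
    by the Chinese remainder theorem it represents -1 modulo d. Such a vector
    is exactly what is needed to border the Gram matrix of N into an integral
    one of determinant 1.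

    A positive ternary lattice of determinant 1 is I_3 or B + <1>
    (ternary_classified). Take a binary section of determinant d, and let c be
    the norm of the shorter vector of a reduced basis of it. Reduction modulo
    the ring of integers, whose covering radius squared is 9/11, gives
    2 c^2 <= 11 d. By unimodularity the orthogonal complement of that vector is
    a binary section of determinant c, so d can be lowered to c unless d <= c.
    Finitely many reduced sections satisfy d <= c (reduced_section): those of
    determinant 1, which split off and are <1,1> or B, and 2 B, which would make
    the ternary determinant even.

    The lattice B + <1> is visibly contained in <1,1> + B. It remains to embed
    N when N lies in I_3 (rep_quat_sum3). The residue field of omega is F_3, so
    the three coordinates of N in I_3, viewed as vectors of F_3^2, are linearly
    dependent: some signed sum of one, two or three of them is divisible by
    omega. The sublattice of <1,1> where x_1 - x_2 is divisible by omega is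
    also a sublattice of B (B is a neighbour of <1,1> at omega), and the
    sublattice of I_3 where x_1 + x_2 + x_3 is divisible by omega is one of
    B + <1>. A single coordinate divisible by omega is the first case after
    adding a fourth coordinate equal to 0. *)

(** * The ring of integers as pairs of integers *)

(** The pair (p, q) stands for p + q * omega. *)
Definition OE : Type := (int * int)%type.
HB.instance Definition _ := GRing.Zmodule.copy OE (int * int)%type.

Definition mulO (u v : OE) : OE :=
  (u.1 * v.1 - 3 * (u.2 * v.2), u.1 * v.2 + u.2 * v.1 + u.2 * v.2).
Definition oneO : OE := (1, 0).

Lemma OE_eq (u v : OE) : u.1 = v.1 -> u.2 = v.2 -> u = v.
Proof. by case: u v => [a b] [c d] /= -> ->. Qed.

Fact mulOA : associative mulO.
Proof. by move=> u v w; apply: OE_eq; rewrite /mulO /=; ring. Qed.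
Fact mulOC : commutative mulO.
Proof. by move=> u v; apply: OE_eq; rewrite /mulO /=; ring. Qed.
Fact mul1O : left_id oneO mulO.
Proof. by move=> u; apply: OE_eq; rewrite /mulO /=; ring. Qed.
Fact mulODl : left_distributive mulO +%R.
Proof. by move=> u v w; apply: OE_eq; rewrite /mulO /=; ring. Qed.
Fact oneO_neq0 : oneO != 0.
Proof. by []. Qed.

HB.instance Definition _ := GRing.Zmodule_isComNzRing.Build OE
  mulOA mulOC mul1O mulODl oneO_neq0.

Definition cj (u : OE) : OE := (u.1 + u.2, - u.2).
Fact cj_zmod : zmod_morphism cj.
Proof. by move=> u v; apply: OE_eq; rewrite /cj /=; ring. Qed.
Fact cj_mul : monoid_morphism cj.
Proof. by split=> [|u v]; apply: OE_eq; rewrite /cj //=; ring. Qed.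
HB.instance Definition _ := GRing.isZmodMorphism.Build OE OE cj cj_zmod.
HB.instance Definition _ := GRing.isMonoidMorphism.Build OE OE cj cj_mul.

Definition om : OE := (0, 1).
(** The norm and the trace are sums: locked, they are not unfolded by rewriting
    with a law of addition. *)
Definition nrm (u : OE) : int := locked (u.1 ^+ 2 + u.1 * u.2 + 3 * u.2 ^+ 2).
Definition tr (u : OE) : int := locked (2 * u.1 + u.2).

Arguments nrm u%_ring_scope.
Arguments tr u%_ring_scope.
Arguments cj u%_ring_scope.

Lemma nrm_def u : nrm u = u.1 ^+ 2 + u.1 * u.2 + 3 * u.2 ^+ 2.
Proof. by rewrite /nrm -lock. Qed.

Lemma tr_def u : tr u = 2 * u.1 + u.2.
Proof. by rewrite /tr -lock. Qed.

Lemma cjK : involutive cj.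
Proof. by move=> u; apply: OE_eq; rewrite /cj /=; ring. Qed.

Lemma intrO (n : int) : n%:~R = (n, 0) :> OE.
Proof.
have natO (k : nat) : k%:R = (k%:Z, 0) :> OE.
  elim: k => // k IHk; rewrite -addn1 natrD IHk; apply: OE_eq => //=; lia.
by case: n => k; rewrite ?NegzE ?mulrNz -pmulrn natO.
Qed.

Lemma nrmE u : (nrm u)%:~R = u * cj u.
Proof. by rewrite intrO; apply: OE_eq; rewrite /cj nrm_def /=; ring. Qed.

Lemma trE u : (tr u)%:~R = u + cj u.
Proof. by rewrite intrO; apply: OE_eq; rewrite /cj tr_def /=; ring. Qed.

Lemma nrm_cj u : nrm (cj u) = nrm u.
Proof. by rewrite !nrm_def /cj /=; ring. Qed.

Lemma nrm_int (n : int) : nrm n%:~R = n ^+ 2.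
Proof. by rewrite intrO nrm_def /=; ring. Qed.

Lemma nrm1 : nrm 1 = 1. Proof. by rewrite nrm_def. Qed.

Lemma cj_om : cj om = 1 - om. Proof. by []. Qed.
Lemma om_sqr : om * om = om - 3%:~R. Proof. by []. Qed.

Lemma nrm_ge0 u : 0 <= nrm u.
Proof. by rewrite nrm_def; nia. Qed.

Lemma intO_inj : injective (fun n : int => n%:~R : OE).
Proof. by move=> m n /=; rewrite !intrO => -[]. Qed.

Lemma nrmM u v : nrm (u * v) = nrm u * nrm v.
Proof. by apply: intO_inj; rewrite /= intrM !nrmE rmorphM /=; ring. Qed.

(** * Representations of Gram matrices *)

Definition star m n (X : 'M[OE]_(m, n)) : 'M_(n, m) := map_mx cj X^T.

Definition rep m n (M : 'M[OE]_m) (N : 'M[OE]_n) : Prop :=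
  exists X : 'M_(n, m), N = X *m M *m star X.

Lemma starM m n p (X : 'M_(m, n)) (Y : 'M_(n, p)) :
  star (X *m Y) = star Y *m star X.
Proof. by rewrite /star trmx_mul map_mxM. Qed.

Lemma rep_trans m n p (M : 'M_n) (L : 'M_m) (N : 'M_p) :
  rep L M -> rep M N -> rep L N.
Proof.
by move=> [X ->] [Y ->]; exists (Y *m X); rewrite starM !mulmxA.
Qed.

Definition mxs m n (s : seq (seq OE)) : 'M[OE]_(m, n) :=
  \matrix_(i, j) nth 0 (nth [::] s i) j.

Definition bin (a : int) (b : OE) (c : int) : 'M[OE]_2 :=
  mxs 2 2 [:: [:: a%:~R; b]; [:: cj b; c%:~R]].

Definition tern (a : int) (b : OE) (c : int) (x y : OE) (z : int) : 'M[OE]_3 :=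
  mxs 3 3 [:: [:: a%:~R; b; x]; [:: cj b; c%:~R; y]; [:: cj x; cj y; z%:~R]].

Lemma cjD u v : cj (u + v) = cj u + cj v. Proof. exact: rmorphD. Qed.
Lemma cjM u v : cj (u * v) = cj u * cj v. Proof. exact: rmorphM. Qed.
Lemma cjN u : cj (- u) = - cj u. Proof. exact: rmorphN. Qed.
Lemma cj_int (n : int) : cj n%:~R = n%:~R. Proof. exact: rmorph_int. Qed.

Ltac mx_cases :=
  apply/matrixP => -[[|[|[|[|?]]]] ?] -[[|[|[|[|?]]]] ?] //;
  rewrite !(mxE, big_ord_recl, big_ord0) /=.

Ltac conj_norm := rewrite ?(cjD, cjN, cjM, cjK, cj_int, cj_om).


(** * Values of the norm form modulo primes *)

(** Each square has at most two roots, and p is odd. *)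
Lemma card_squares (p : nat) : prime p -> odd p ->
  (p < 2 * #|[set x ^+ 2 | x : 'F_p]|)%N.
Proof.
move=> pp podd; set S := [set _ | _ in _].
have pS : (p <= 2 * #|S|)%N.
  rewrite -{1}(card_Fp pp) -[X in (X <= _)%N]sum1_card.
  rewrite (partition_big (fun x : 'F_p => x ^+ 2) (mem S)) /=; last first.
    by move=> x _; apply: imset_f.
  have -> : (2 * #|S| = \sum_(y in S) 2)%N by rewrite sum_nat_const mulnC.
  apply: leq_sum => y /imsetP[x _ ->].
  rewrite sum1_card; apply: leq_trans (_ : #|[set x; - x]| <= _)%N.
    by apply/subset_leq_card/subsetP => z; rewrite unfold_in /= => zx; rewrite !inE -eqf_sqr.
  by rewrite cards2; case: (_ != _).
by rewrite ltn_neqAle pS andbT; apply: contraL podd => /eqP->; rewrite mul2n odd_double.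
Qed.

(** For odd p, 4 (x^2 + x y + 3 y^2) = (2 x + y)^2 + 11 y^2, and the set of
    squares and the set of values 4 t - 11 y^2 are too large to be disjoint. *)
Lemma norm_form_surj_Fp (p : nat) (t : 'F_p) : prime p -> p != 11%N ->
  exists x y : 'F_p, x ^+ 2 + x * y + 3%:R * y ^+ 2 = t.
Proof.
move=> pp p11; have [p2|podd] := even_prime pp.
  move: t; rewrite p2 => t; exists t, 0.
  by rewrite mulr0 expr0n /= mulr0 !addr0; case: t => -[|[|//]] i; apply/val_inj.
have neq0 (q : nat) : prime q -> p != q -> q%:R != 0 :> 'F_p.
  move=> pq; apply: contra; rewrite -(dvdn_pcharf (pchar_Fp pp)).
  by rewrite dvdn_prime2.
have n2 : 2%:R != 0 :> 'F_p by apply: neq0 => //; apply: contraTneq podd => ->.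
have n11 : 11%:R != 0 :> 'F_p by apply: neq0.
pose S := [set x ^+ 2 | x : 'F_p].
pose f (y : 'F_p) := 4%:R * t - 11%:R * y.
have f_inj : injective f.
  by move=> y z /addrI/oppr_inj/(mulfI n11).
have : ~~ [disjoint S & f @: S].
  have := card_squares pp podd; rewrite -/S => cS.
  apply/negP; rewrite -setI_eq0 => /eqP SI; have := cardsUI S (f @: S).
  rewrite SI cards0 addn0 (card_imset _ f_inj) => cU.
  have := max_card (S :|: f @: S); rewrite cU card_Fp // addnn -mul2n leqNgt cS //.
rewrite -setI_eq0 => /set0Pn[_ /setIP[/imsetP[u _ ->] /imsetP[_ /imsetP[y _ ->]]]].
rewrite /f => e; exists ((u - y) / 2%:R), y.
have n4 : 4%:R != 0 :> 'F_p by rewrite (natrM _ 2 2) mulf_neq0.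
apply: (mulfI n4).
have -> : 4%:R * t = u ^+ 2 + 11%:R * y ^+ 2 by rewrite e; ring.
by field.
Qed.

Lemma nrm_surj (p : nat) (t : int) : prime p -> p != 11%N ->
  exists u : OE, (p %| nrm u - t)%Z.
Proof.
move=> pp p11; have [x [y e]] := norm_form_surj_Fp t%:~R pp p11.
exists ((x : nat)%:Z, (y : nat)%:Z).
rewrite (dvdz_pcharf (pchar_Fp pp)) nrm_def /= !(rmorphD, rmorphN, rmorphM, rmorphXn) /=.
rewrite -!pmulrn !natr_Zp -e; apply/eqP; ring.
Qed.

(** * Enlarging binary lattices *)

(** The value of the form at the vector u e1 + v e2. *)
Definition val2 (a : int) (b : OE) (c : int) (u v : OE) : int :=
  locked (a * nrm u + tr (b * (u * cj v)) + c * nrm v).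

Arguments val2 (a b c u v)%_ring_scope.

Lemma val2_def a b c u v :
  val2 a b c u v = a * nrm u + tr (b * (u * cj v)) + c * nrm v.
Proof. by rewrite /val2 -lock. Qed.

Definition det2 (a : int) (b : OE) (c : int) : int := a * c - nrm b.

Arguments det2 (a b c)%_ring_scope.

Definition posb (a : int) (b : OE) (c : int) : bool :=
  [&& 0 < a, 0 < c & 0 < det2 a b c].

Lemma val2E a b c u v : (val2 a b c u v)%:~R =
  a%:~R * (u * cj u) + (b * u * cj v + cj b * cj u * v) + c%:~R * (v * cj v) :> OE.
Proof.
by rewrite val2_def !intrD !intrM trE !nrmE; conj_norm; ring.
Qed.

Lemma posb_swap a b c : posb c (cj b) a = posb a b c.
Proof. by rewrite /posb /det2 nrm_cj (mulrC c) andbCA. Qed.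

Lemma rep_swap a b c : rep (bin c (cj b) a) (bin a b c).
Proof.
exists (mxs 2 2 [:: [:: 0; 1]; [:: 1; 0]]).
by mx_cases; conj_norm; ring.
Qed.

(** Adjoining (e1 + s e2) / pi: the new basis is this vector and e2. *)
Lemma overlattice pi s a b c a' b' :
    b + s * c%:~R = pi * b' -> val2 a b c 1 s = nrm pi * a' ->
  rep (bin a' b' c) (bin a b c) /\ det2 a b c = nrm pi * det2 a' b' c.
Proof.
move=> eb /(congr1 (fun n : int => n%:~R : OE)).
rewrite val2E intrM nrmE.
have {eb}-> : b = pi * b' - s * c%:~R by rewrite -eb addrK.
conj_norm; rewrite rmorph1 => ea.
have {}ea : a%:~R = pi * cj pi * a'%:~R - pi * b' * cj s
    - cj pi * cj b' * s + s * c%:~R * cj s by rewrite -ea; ring.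
split.
  exists (mxs 2 2 [:: [:: pi; - s]; [:: 0; 1]]).
  by mx_cases; rewrite ?ea; conj_norm; ring.
apply: intO_inj; rewrite /= /det2 !(intrM, intrB) ea !nrmE; conj_norm; ring.
Qed.

Definition enlargeable a b c : Prop := exists a' b' c',
  [/\ posb a' b' c', det2 a' b' c' < det2 a b c & rep (bin a' b' c') (bin a b c)].

Lemma enlarge pi s a b c a' b' :
    posb a b c -> 1 < nrm pi ->
    b + s * c%:~R = pi * b' -> val2 a b c 1 s = nrm pi * a' ->
  enlargeable a b c.
Proof.
move=> /and3P[a0 c0 d0] P1 eb ea; have [rN ed] := overlattice eb ea.
have d'0 : 0 < det2 a' b' c by nia.
exists a', b', c; split=> //; last by nia.
apply/and3P; split=> //; have := nrm_ge0 b'; move: d'0; rewrite /det2; nia.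
Qed.

Lemma enlarge_swap a b c : enlargeable c (cj b) a -> enlargeable a b c.
Proof.
move=> [a' [b' [c' [p' d' r']]]]; exists a', b', c'; split=> //.
  by move: d'; rewrite /det2 nrm_cj (mulrC c).
exact: rep_trans r' (rep_swap a b c).
Qed.

Lemma shear s a b c :
  let a' := val2 a b c 1 s in let b' := b + s * c%:~R in
  rep (bin a' b' c) (bin a b c) /\ det2 a' b' c = det2 a b c.
Proof.
have [] := @overlattice 1 s a b c (val2 a b c 1 s) (b + s * c%:~R).
- by rewrite mul1r.
- by rewrite nrm1 mul1r.
by move=> r d; split; rewrite // d nrm1 mul1r.
Qed.

Lemma enlarge_shear s a b c : posb a b c ->
    (posb (val2 a b c 1 s) (b + s * c%:~R) c ->
     enlargeable (val2 a b c 1 s) (b + s * c%:~R) c) ->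
  enlargeable a b c.
Proof.
move=> /and3P[a0 c0 d0] h; have [r d] := shear s a b c.
case: h => [|a' [b' [c' [p' d' r']]]].
  rewrite /posb d d0 c0 !andbT.
  move: d d0; rewrite /det2; have := nrm_ge0 (b + s * c%:~R).
  by move: (val2 _ _ _ _ _) (nrm (b + _)) (nrm b) => x y z y0 e d0; nia.
exists a', b', c'; split=> //; first by rewrite -d.
exact: rep_trans r' r.
Qed.

Lemma dvdzDl (d m n : int) : (d %| m)%Z -> (d %| m + n)%Z = (d %| n)%Z.
Proof. exact: rpredDl. Qed.

Lemma dvdzDr (d m n : int) : (d %| n)%Z -> (d %| m + n)%Z = (d %| m)%Z.
Proof. exact: rpredDr. Qed.

Lemma prime_coprimez (p : nat) (c : int) :
  prime p -> ~~ (p %| c)%Z -> coprimez p c.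
Proof. by move=> pp; rewrite dvdzE coprimezE /= prime_coprime. Qed.

Lemma prime_dvdz_mul (p : nat) (m n : int) :
  prime p -> (p %| m * n)%Z -> (p %| m)%Z || (p %| n)%Z.
Proof. by move=> pp; rewrite !dvdzE abszM /= Euclid_dvdM. Qed.

Lemma prime_inverse (p : nat) (c : int) :
  prime p -> ~~ (p %| c)%Z -> exists i k : int, i * c = 1 + k * p%:Z.
Proof.
move=> pp /(prime_coprimez pp)/coprimezP[[u v] /= e].
by exists v, (- u); lia.
Qed.

Lemma intO_dvd (n : int) (u : OE) :
  (n %| u.1)%Z -> (n %| u.2)%Z -> exists u', u = n%:~R * u'.
Proof.
move=> /dvdzP[x ex] /dvdzP[y ey]; exists (x, y).
by rewrite intrO; apply: OE_eq; rewrite ?ex ?ey /=; ring.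
Qed.

(** Completing the square, that is, splitting e1 + s e2 into its components along
    e2 and orthogonal to e2. *)
Lemma val2_mul_c a b c s :
  c * val2 a b c 1 s = nrm (b + s * c%:~R) + det2 a b c.
Proof.
apply: intO_inj; rewrite /= intrD intrM val2E nrmE intrB intrM nrmE.
by conj_norm; rewrite rmorph1; ring.
Qed.

Lemma val2_1_0 a b c : val2 a b c 1 0 = a.
Proof.
by apply: intO_inj; rewrite /= val2E rmorph0 rmorph1; ring.
Qed.

Lemma val2_scale (n : int) a b c u v :
  val2 (n * a) (n%:~R * b) (n * c) u v = n * val2 a b c u v.
Proof.
apply: intO_inj; rewrite /= intrM !val2E !intrM; conj_norm; ring.
Qed.

(** A square root of -11. *)
Definition theta : OE := (-1, 2).
Lemma nrm_theta : nrm theta = 11. Proof. by rewrite nrm_def. Qed.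

(** Modulo theta = sqrt(-11), omega is congruent to 6 = 1/2. *)
Lemma theta_dvd (u : OE) : (11 %| u.1 + 6 * u.2)%Z -> exists u', u = theta * u'.
Proof.
move=> /dvdzP[k ek]; exists (k, u.2 - 2 * k).
by apply: OE_eq => /=; lia.
Qed.

Lemma nrm_mod11 (u : OE) : (11 %| nrm u)%Z = (11 %| u.1 + 6 * u.2)%Z.
Proof.
have -> : nrm u = (u.1 + 6 * u.2) ^+ 2 + 11 * (- u.1 * u.2 - 3 * u.2 ^+ 2).
  by rewrite nrm_def; ring.
rewrite (@dvdzDr _ (_ ^+ 2)); last exact: dvdz_mulr (dvdzz _).
by apply/idP/idP=> [/(@prime_dvdz_mul 11)|/dvdz_mulr->//]; rewrite orbb => ->.
Qed.

(** As theta has residue field F_11, the multiplier s can be an integer k. *)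
Lemma enlarge_theta (k a : int) (b : OE) c : posb a b c ->
    (11 %| b.1 + 6 * b.2 + k * c)%Z -> (11 %| val2 a b c 1 k%:~R)%Z ->
  enlargeable a b c.
Proof.
move=> pos db /dvdzP[a' ea].
have [|b' eb] := @theta_dvd (b + k%:~R * c%:~R).
  by rewrite -intrM intrO /= addr0 addrAC.
apply: (enlarge pos _ eb); first by rewrite nrm_theta.
by rewrite ea nrm_theta mulrC.
Qed.

(** The Gram matrix is singular modulo theta: if e1 + s e2 lies in its radical,
    the norm of this vector is an integer divisible by theta, hence by 11, and
    (e1 + s e2) / theta can be adjoined. *)
Lemma enlarge_11 a b c : posb a b c -> (11 %| det2 a b c)%Z -> enlargeable a b c.
Proof.
have unit_c a' b' c' : posb a' b' c' -> (11 %| det2 a' b' c')%Z ->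
    ~~ (11 %| c')%Z -> enlargeable a' b' c'.
  move=> pos d0 nc; have [i [k ik]] := @prime_inverse 11 _ isT nc.
  have dk : (11 %| b'.1 + 6 * b'.2 + (- (b'.1 + 6 * b'.2) * i) * c')%Z.
    rewrite -mulrA ik; apply/dvdzP; exists (- (b'.1 + 6 * b'.2) * k); lia.
  apply: (enlarge_theta pos dk).
  rewrite -(Gauss_dvdzr _ (@prime_coprimez 11 _ isT nc)) val2_mul_c.
  rewrite rpredD // nrm_mod11 -intrM intrO /= addr0.
  by rewrite addrAC.
move=> pos d0; have [c0|] := boolP (11 %| c)%Z; last exact: unit_c.
have [a0|na] := boolP (11 %| a)%Z; last first.
  apply/enlarge_swap/unit_c; rewrite ?posb_swap //.
  by move: d0; rewrite /det2 nrm_cj mulrC.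
apply: (@enlarge_theta 0); rewrite ?val2_1_0 // mul0r addr0 -nrm_mod11.
by move: d0; rewrite /det2 rpredBl // dvdz_mulr.
Qed.

Section PrimeSquare.

Variables (p : nat) (pp : prime p).

Let nrm_p : nrm p%:~R = p%:Z ^+ 2. Proof. exact: nrm_int. Qed.

Let p1 : 1 < nrm p%:~R.
Proof. by rewrite nrm_p; have := prime_gt1 pp; nia. Qed.

(** As c is invertible modulo p, some e1 + s e2 is orthogonal to e2 modulo p.
    By val2_mul_c its norm is divisible by p^2, so it can be divided by p. *)
Lemma enlarge_unit_c a b c : posb a b c -> (p%:Z ^+ 2 %| det2 a b c)%Z ->
  ~~ (p %| c)%Z -> enlargeable a b c.
Proof.
move=> pos d0 nc; have [i [k ik]] := prime_inverse pp nc.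
pose s : OE := - (i%:~R * b).
have eb : b + s * c%:~R = p%:~R * (- k%:~R * b).
  have eO : i%:~R * c%:~R = 1 + k%:~R * p%:~R :> OE by rewrite -!intrM ik intrD.
  by rewrite /s mulNr mulrAC eO; ring.
have /dvdzP[a' ea] : (p%:Z ^+ 2 %| val2 a b c 1 s)%Z.
  have cp : coprimez (p%:Z ^+ 2) c by apply/coprimezXl/prime_coprimez.
  by rewrite -(Gauss_dvdzr _ cp) val2_mul_c rpredD // eb nrmM nrm_p dvdz_mulr.
by apply: (enlarge pos p1 eb); rewrite ea nrm_p mulrC.
Qed.

Lemma enlarge_unit_a a b c : posb a b c -> (p%:Z ^+ 2 %| det2 a b c)%Z ->
  ~~ (p %| a)%Z -> enlargeable a b c.
Proof.
move=> pos d0 na; apply/enlarge_swap/enlarge_unit_c; rewrite ?posb_swap //.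
by rewrite /det2 nrm_cj mulrC.
Qed.

Hypothesis p11 : p != 11%N.

(** The norms of e1 + e2 and e1 + omega e2 control the traces of b and of
    b conj(omega), and these determine b modulo p because the different,
    generated by theta, is prime to p. *)
Lemma not_dvd_value a (b : OE) c : (p %| a)%Z -> (p %| c)%Z ->
    ~~ ((p %| b.1)%Z && (p %| b.2)%Z) ->
  exists s, ~~ (p %| val2 a b c 1 s)%Z.
Proof.
move=> a0 c0 nb.
have valp s : (p %| val2 a b c 1 s)%Z = (p %| tr (b * cj s))%Z.
  by rewrite val2_def mul1r addrAC dvdzDl // rpredD // dvdz_mulr.
have [b1|] := boolP (p %| tr (b * cj 1))%Z; last by exists 1; rewrite valp.
have [bo|] := boolP (p %| tr (b * cj om))%Z; last by exists om; rewrite valp.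
case/negP: nb; move: b1 bo; rewrite !tr_def /= => /dvdzP[x ex] /dvdzP[y ey].
have cp : coprimez p 11 by rewrite coprimezE /= prime_coprime // dvdn_prime2.
have d2 : (p %| b.2)%Z.
  by rewrite -(Gauss_dvdzr _ cp); apply/dvdzP; exists (2 * y - x); lia.
rewrite d2 andbT; have /dvdzP[z ez] := d2.
by apply/dvdzP; exists (y - 6 * z); lia.
Qed.

(** By val2_mul_c, e1 + s e2 is isotropic modulo p for the form (a, b, c) once
    b + s c has norm -det2 a b c modulo p, which nrm_surj makes possible. For
    the form scaled by p, this vector can be divided by p. *)
Lemma enlarge_scaled_unit_c a b c :
    posb (p%:Z * a) (p%:~R * b) (p%:Z * c) -> ~~ (p %| c)%Z ->
  enlargeable (p%:Z * a) (p%:~R * b) (p%:Z * c).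
Proof.
move=> pos nc; have [i [k ik]] := prime_inverse pp nc.
have [t tP] := nrm_surj (- det2 a b c) pp p11.
pose s : OE := (t - b) * i%:~R.
have es : b + s * c%:~R = t + p%:~R * ((t - b) * k%:~R).
  have eO : i%:~R * c%:~R = 1 + k%:~R * p%:~R :> OE by rewrite -!intrM ik intrD.
  by rewrite /s -mulrA eO; ring.
have nD u v : nrm (u + p%:~R * v) = nrm u + p%:Z * (tr (u * cj v) + p%:Z * nrm v).
  apply: intO_inj; rewrite /= !(intrD, intrM) trE !nrmE; conj_norm; ring.
have /dvdzP[a' ea] : (p %| val2 a b c 1 s)%Z.
  rewrite -(Gauss_dvdzr _ (prime_coprimez pp nc)) val2_mul_c es nD.
  by rewrite addrAC rpredD ?dvdz_mulr // -[det2 _ _ _]opprK.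
apply: (@enlarge p%:~R s _ _ _ a' (b + s * c%:~R) pos p1).
  by rewrite intrM; ring.
by rewrite val2_scale ea nrm_p; ring.
Qed.

Lemma enlarge_scaled a b c :
    posb (p%:Z * a) (p%:~R * b) (p%:Z * c) ->
  enlargeable (p%:Z * a) (p%:~R * b) (p%:Z * c).
Proof.
move=> pos; have [c0|] := boolP (p %| c)%Z; last exact: enlarge_scaled_unit_c.
have [/dvdzP[a' ea]|na] := boolP (p %| a)%Z.
  apply: (@enlarge p%:~R 0 _ _ _ a' b pos p1); first by rewrite mul0r addr0.
  by rewrite val2_1_0 nrm_p ea; ring.
apply: enlarge_swap; conj_norm; apply: enlarge_scaled_unit_c na.
by rewrite -posb_swap; conj_norm.
Qed.

(** Either the form is p times an integral one, or after a shear a diagonal entry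
    is prime to p. *)
Lemma enlarge_prime_sqr a b c :
  posb a b c -> (p%:Z ^+ 2 %| det2 a b c)%Z -> enlargeable a b c.
Proof.
move=> pos d0; have [c0|] := boolP (p %| c)%Z; last exact: enlarge_unit_c.
have [a0|] := boolP (p %| a)%Z; last exact: enlarge_unit_a.
have [/andP[/intO_dvd h/h[b' eb]]|nb] := boolP ((p %| b.1)%Z && (p %| b.2)%Z).
  case/dvdzP: c0 pos => c' ->; case/dvdzP: a0 => a' ->.
  by rewrite eb ![_ * p%:Z]mulrC; exact: enlarge_scaled.
have [s ns] := not_dvd_value a0 c0 nb.
apply: (@enlarge_shear s _ _ _ pos) => pos'; apply: (enlarge_unit_a pos' _ ns).
by have [_ ->] := shear s a b c.
Qed.

End PrimeSquare.

(** * Binary lattices representing -1 modulo their determinant *)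

Lemma val2_homog a b c t u v : val2 a b c (t * u) (t * v) = nrm t * val2 a b c u v.
Proof.
by apply: intO_inj; rewrite /= intrM !val2E nrmE; conj_norm; ring.
Qed.

Lemma unit_value (p : nat) a b c : prime p -> p != 11%N ->
    ~~ (p%:Z ^+ 2 %| det2 a b c)%Z ->
  exists u v, ~~ (p %| val2 a b c u v)%Z.
Proof.
move=> pp p11 nd; have [a0|na] := boolP (p %| a)%Z; last first.
  by exists 1, 0; rewrite val2_1_0.
have [c0|nc] := boolP (p %| c)%Z; last first.
  exists 0, 1; suff -> : val2 a b c 0 1 = c by [].
  by apply: intO_inj; rewrite /= val2E rmorph0 rmorph1; ring.
have [/andP[b1 b2]|nb] := boolP ((p %| b.1)%Z && (p %| b.2)%Z).
  case/negP: nd; have [b' ->] := intO_dvd b1 b2.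
  case/dvdzP: a0 => a' ->; case/dvdzP: c0 => c' ->.
  apply/dvdzP; exists (det2 a' b' c').
  by rewrite /det2 nrmM nrm_int; ring.
by have [s ns] := not_dvd_value pp p11 a0 c0 nb; exists 1, s.
Qed.

(** From a value h prime to p: scaling a vector by t multiplies h by the norm of
    t, which can be any residue. *)
Lemma minus_one_mod_prime (p : nat) a b c : prime p -> p != 11%N ->
    ~~ (p%:Z ^+ 2 %| det2 a b c)%Z ->
  exists u v, (p %| val2 a b c u v + 1)%Z.
Proof.
move=> pp p11 /(unit_value pp p11)[u [v nh]].
have [i [k ik]] := prime_inverse pp nh.
have [t /dvdzP[q eq]] := nrm_surj (- i) pp p11.
exists (t * u), (t * v); rewrite val2_homog; apply/dvdzP.
exists (q * val2 a b c u v - k).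
have -> : nrm t = q * p%:Z - i by lia.
by rewrite mulrBl ik; ring.
Qed.

Lemma val2_mod (m : int) a b c u v x y :
  (m %| val2 a b c (u + m%:~R * x) (v + m%:~R * y) + 1)%Z
  = (m %| val2 a b c u v + 1)%Z.
Proof.
pose k := tr (a%:~R * u * cj x + b * u * cj y + cj b * v * cj x
              + c%:~R * v * cj y) + m * val2 a b c x y.
have -> : val2 a b c (u + m%:~R * x) (v + m%:~R * y) = m * k + val2 a b c u v.
  apply: intO_inj; rewrite /k /= !(intrM, intrD) trE !val2E.
  by conj_norm; ring.
by rewrite -addrA; apply: dvdzDl; apply: dvdz_mulr (dvdzz _).
Qed.

Lemma minus_one_crt (m n : int) a b c : coprimez m n ->
    (exists u v, (m %| val2 a b c u v + 1)%Z) ->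
    (exists u v, (n %| val2 a b c u v + 1)%Z) ->
  exists u v, (m * n %| val2 a b c u v + 1)%Z.
Proof.
move=> cmn [u1 [v1 d1]] [u2 [v2 d2]].
have /coprimezP[[i j] /= ij] := cmn.
have ijO : i%:~R * m%:~R + j%:~R * n%:~R = 1 :> OE by rewrite -!intrM -intrD ij.
pose lift (w1 w2 : OE) := w1 + m%:~R * (i%:~R * (w2 - w1)).
have liftE w1 w2 : lift w1 w2 = w2 + n%:~R * (j%:~R * (w1 - w2)).
  rewrite /lift; apply/eqP; rewrite -subr_eq0.
  have -> : w1 + m%:~R * (i%:~R * (w2 - w1)) - (w2 + n%:~R * (j%:~R * (w1 - w2)))
    = (1 - (i%:~R * m%:~R + j%:~R * n%:~R)) * (w1 - w2) by ring.
  by rewrite ijO subrr mul0r.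
exists (lift u1 u2), (lift v1 v2); rewrite Gauss_dvdz //; apply/andP; split.
  by rewrite val2_mod.
by rewrite !liftE val2_mod.
Qed.

Lemma minus_one_mod (m : nat) a b c : (0 < m)%N ->
    (forall p : nat, prime p -> (p %| m)%N -> ~~ (p ^ 2 %| m)%N) ->
    (forall p : nat, prime p -> (p %| m)%N ->
       exists u v, (p %| val2 a b c u v + 1)%Z) ->
  exists u v, (m %| val2 a b c u v + 1)%Z.
Proof.
elim/ltn_ind: m => m IHm m0 sqf loc.
have [m1|m1] := leqP m 1.
  by exists 0, 0; rewrite (_ : m = 1%N) ?dvd1z //; lia.
have pp := pdiv_prime m1; have pm := pdiv_dvd m.
move: (pdiv m) pp pm => p pp pm; have /dvdnP[q eq] := pm.
have p1 := prime_gt1 pp.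
have q0 : (0 < q)%N by nia.
have cpq : coprimez p q.
  rewrite coprimezE /= prime_coprime //; apply: contra (sqf p pp pm) => pq.
  by rewrite eq -mulnn dvdn_mul.
rewrite eq PoszM mulrC; apply: minus_one_crt => //; first exact: loc.
have qm : (q %| m)%N by rewrite eq dvdn_mulr.
apply: IHm => //; first by nia.
  move=> r rp rq; apply: contra (sqf r rp (dvdn_trans rq qm)) => rrq.
  exact: dvdn_trans rrq qm.
by move=> r rp rq; apply: loc => //; exact: dvdn_trans rq qm.
Qed.

Lemma enlargeable_or_minus_one a b c : posb a b c ->
  enlargeable a b c \/ exists u v, (det2 a b c %| val2 a b c u v + 1)%Z.
Proof.
move=> pos; have /and3P[_ _ d0] := pos.
have [m md] : exists m : nat, det2 a b c = m%:Z by exists `|det2 a b c|%N; lia.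
have [d11|n11] := boolP (11 %| det2 a b c)%Z; first by left; exact: enlarge_11.
have [/hasP[p]|/hasPn sqf] := boolP (has (fun p => p ^ 2 %| m)%N (primes m)).
  rewrite mem_primes => /and3P[pp _ pm] p2m; left.
  have p11 : p != 11%N.
    by apply: contra n11 => /eqP e; move: pm; rewrite md dvdzE e.
  by apply: (enlarge_prime_sqr pp p11 pos); rewrite md dvdzE abszX.
right; rewrite md; have m0 : (0 < m)%N by lia.
have sqf' (p : nat) : prime p -> (p %| m)%N -> ~~ (p ^ 2 %| m)%N.
  by move=> pp pm; apply: sqf; rewrite mem_primes pp m0.
apply: minus_one_mod => // p pp pm; apply: minus_one_mod_prime => //.
  by apply: contra n11 => /eqP e; move: pm; rewrite md dvdzE e.
by rewrite md dvdzE abszX; exact: sqf'.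
Qed.

(** * Ternary lattices of determinant one *)

(** The determinant of tern a b c x y z: the adjugate of the section (a, b, c)
    takes at (x, y) the value of the section itself at (y, - x). *)
Definition tdet a b c x y z : int := z * det2 a b c - val2 a b c y (- x).

Lemma rep_bin_tern a b c x y z : rep (tern a b c x y z) (bin a b c).
Proof.
exists (mxs 2 3 [:: [:: 1; 0; 0]; [:: 0; 1; 0]]).
by mx_cases; conj_norm; ring.
Qed.

Lemma unimodular_ternary a b c : posb a b c ->
  exists a' b' c' x y z, [/\ posb a' b' c', tdet a' b' c' x y z = 1
    & rep (tern a' b' c' x y z) (bin a b c)].
Proof.
have [n] := ubnP `|det2 a b c|%N; elim: n => // n IHn in a b c * => dn pos.
have [[a' [b' [c' [p' d' r']]]]|] := enlargeable_or_minus_one pos.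
  have [|a1 [b1 [c1 [x [y [z [p1 t1 r1]]]]]]] := IHn a' b' c' _ p'.
    by case/and3P: p' => _ _ p'; move: dn; lia.
  by exists a1, b1, c1, x, y, z; split=> //; exact: rep_trans r1 r'.
move=> [u [v /dvdzP[z ez]]]; exists a, b, c, (- v), u, z; split=> //.
  by rewrite /tdet opprK -ez; ring.
exact: rep_bin_tern.
Qed.

Lemma tern_swap a b c x y z :
  rep (tern c (cj b) a y x z) (tern a b c x y z)
  /\ tdet c (cj b) a y x z = tdet a b c x y z.
Proof.
split.
  exists (mxs 3 3 [:: [:: 0; 1; 0]; [:: 1; 0; 0]; [:: 0; 0; 1]]).
  by mx_cases; conj_norm; ring.
apply: intO_inj; rewrite /tdet /det2 /= !(intrB, intrM) !val2E !nrmE.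
by conj_norm; ring.
Qed.

Lemma tern_shear s a b c x y z :
  let a' := val2 a b c 1 s in let b' := b + s * c%:~R in let x' := x + s * y in
  rep (tern a' b' c x' y z) (tern a b c x y z)
  /\ tdet a' b' c x' y z = tdet a b c x y z.
Proof.
split.
  exists (mxs 3 3 [:: [:: 1; - s; 0]; [:: 0; 1; 0]; [:: 0; 0; 1]]).
  by mx_cases; rewrite ?val2E; conj_norm; rewrite ?rmorph1; ring.
apply: intO_inj; rewrite /tdet /det2 /= !(intrB, intrM) !val2E !nrmE.
by conj_norm; rewrite ?rmorph1; ring.
Qed.

(** The Gram matrix of the dual basis, with the basis vectors reordered so that
    the binary section has determinant c: a section of a unimodular lattice and
    its orthogonal complement have the same determinant. *)
Lemma tern_dual a b c x y z : tdet a b c x y z = 1 ->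
  let a' := c * z - nrm y in let b' := b * y - x * c%:~R in
  let c' := det2 a b c in let x' := x * cj y - b * z%:~R in
  let y' := b * cj x - a%:~R * cj y in let z' := a * z - nrm x in
  [/\ rep (tern a' b' c' x' y' z') (tern a b c x y z),
      tdet a' b' c' x' y' z' = 1 & det2 a' b' c' = c].
Proof.
move=> t1 a' b' c' x' y' z'.
pose D : OE := z%:~R * (a%:~R * c%:~R - b * cj b)
  - (a%:~R * (y * cj y) - (b * y * cj x + cj b * cj y * x) + c%:~R * (x * cj x)).
have D1 : D = 1.
  rewrite -[RHS](_ : 1%:~R = _) // -t1 /D /tdet /det2.
  by rewrite intrB intrM intrB intrM nrmE val2E; conj_norm; ring.
have scale u : u = u * D :> OE by rewrite D1 mulr1.
split.
- exists (mxs 3 3 [:: [:: a%:~R; x; b]; [:: cj b; y; c%:~R]; [:: cj x; z%:~R; cj y]]).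
  mx_cases; rewrite [LHS]scale /D /a' /b' /c' /x' /y' /z' /det2;
    rewrite ?(intrB, intrM) ?nrmE; conj_norm; ring.
- apply: intO_inj; rewrite /= [RHS](_ : _ = D * D) /D; last by rewrite -/D D1 mulr1.
  rewrite /tdet /a' /b' /c' /x' /y' /z' /det2 !(intrB, intrM) !val2E !nrmE.
  rewrite !(intrB, intrM) !nrmE.
  by conj_norm; ring.
apply: intO_inj; rewrite /= [RHS]scale /D.
rewrite /a' /b' /c' /det2 !(intrB, intrM) !nrmE.
by conj_norm; ring.
Qed.

(** A unimodular section splits off: the projection of e3 to it is integral. *)
Lemma tern_split a b c x y z : det2 a b c = 1 -> tdet a b c x y z = 1 ->
  rep (tern a b c 0 0 1) (tern a b c x y z).
Proof.
move=> d1 t1.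
have d1O : a%:~R * c%:~R - b * cj b = 1 :> OE.
  by rewrite -[RHS](_ : 1%:~R = _) // -d1 /det2 intrB intrM nrmE.
have scale u : u = u * (a%:~R * c%:~R - b * cj b) :> OE by rewrite d1O mulr1.
have zE : z%:~R = 1 + (a%:~R * (y * cj y) - (b * y * cj x + cj b * cj y * x)
       + c%:~R * (x * cj x)) :> OE.
  have -> : z = 1 + val2 a b c y (- x) by move: t1; rewrite /tdet d1; lia.
  by rewrite intrD val2E; conj_norm; ring.
exists (mxs 3 3 [:: [:: 1; 0; 0]; [:: 0; 1; 0];
   [:: cj x * c%:~R - cj y * cj b; cj y * a%:~R - cj x * b; 1]]).
mx_cases; rewrite ?zE; conj_norm; rewrite ?rmorph1 ?rmorph0; try ring.
all: try by rewrite [LHS]scale; ring.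
by rewrite [X in 1 + X = _]scale; ring.
Qed.

(** * Classification of the ternary lattices of determinant one *)

Definition id_tern := tern 1 0 1 0 0 1.
Definition even_tern := tern 2 om 2 0 0 1.

Definition classified (T : 'M[OE]_3) : Prop := rep id_tern T \/ rep even_tern T.

Lemma classified_rep T T' : rep T' T -> classified T' -> classified T.
Proof.
by move=> r [r'|r']; [left|right]; exact: rep_trans r' r.
Qed.

(** The Voronoi cell of the ideal c O, where b is no longer than its translates
    by c, c omega and c conj(omega) and their opposites. *)
Definition hexagon (c : int) (b : OE) : bool :=
  [&& `|tr b| <= c, `|tr (b * cj om)| <= 3 * c & `|tr (b * om)| <= 3 * c].

(** The vertices of the hexagon have norm 9/11 c^2: the covering radius of the
    ring of integers is 3 / sqrt 11. *)
Lemma hexagon_nrm c b : hexagon c b -> 11 * nrm b <= 9 * c ^+ 2.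
Proof.
move=> /and3P[]; rewrite !tr_def nrm_def /=.
move: b.1 b.2 => p q h1 h2 h3.
have {}h1 : `|2 * p + q| <= c by lia.
set U := 2 * p + q in h1.
have h4 : `|U| + `|11 * q| <= 6 * c by rewrite /U in h1 *; lia.
suff : 11 * U ^+ 2 + (11 * q) ^+ 2 <= 36 * c ^+ 2 by rewrite /U; lia.
move: (11 * q) h4 => T h4; have T0 := normr_ge0 T; have U0 := normr_ge0 U.
rewrite -(real_normK (num_real U)) -(real_normK (num_real T)).
move: `|U| `|T| U0 T0 h1 h4 => u t u0 t0 h1 h4.
have : t ^+ 2 <= (6 * c - u) ^+ 2 by nia.
nia.
Qed.

(** Outside the hexagon some e1 + s e2 is shorter than e1: its norm is
    a + tr (b conj(s)) + c nrm s. *)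
Lemma not_hexagon c b : 0 < c -> ~~ hexagon c b ->
  exists s, tr (b * cj s) + c * nrm s < 0.
Proof.
move=> c0; rewrite /hexagon !tr_def /= => h.
have : [|| c < 2 * b.1 + b.2, 2 * b.1 + b.2 < - c,
   3 * c < b.1 + 6 * b.2, b.1 + 6 * b.2 < - (3 * c),
   3 * c < b.1 - 5 * b.2 | b.1 - 5 * b.2 < - (3 * c)] by lia.
case/or4P=> [h1|h1|h1|/or3P[]h1]; [exists (- 1)|exists 1|exists (- om)|exists om
  |exists (- cj om)|exists (cj om)]; rewrite tr_def nrm_def /=; lia.
Qed.

(** By hexagon_nrm, 2 c^2 <= 11 det2 <= 11 c, so that c <= 5. In the last case
    the section is twice a unimodular one. *)
Lemma reduced_section a b c : posb a b c -> hexagon c b -> c <= a ->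
    det2 a b c <= c ->
  [\/ [/\ a = 1, b = 0 & c = 1],
      [/\ a = 2, c = 2 & b \in [:: om; - om; cj om; - cj om]] |
      exists b', [/\ a = 4, c = 4, det2 a b c = 4 & b = 2%:~R * b']].
Proof.
move=> /and3P[a0 c0 d0] hex ca dc; have := hexagon_nrm hex.
have /and3P[h1 h2 h3] := hex; move: h1 h2 h3 d0 dc.
rewrite /det2 !tr_def nrm_def /=; case: b hex => p q _ /= h1 h2 h3 d0 dc h4.
have c5 : c <= 5 by nia.
have [e5|[e5|[e5|[e5|e5]]]] : c = 1 \/ c = 2 \/ c = 3 \/ c = 4 \/ c = 5 by lia.
all: have [e2|[e2|[e2|[e2|e2]]]] : q = -2 \/ q = -1 \/ q = 0 \/ q = 1 \/ q = 2 by lia.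
all: rewrite e5 e2 in h1 h2 h3 h4 d0 dc ca *.
all: have [e1|[e1|[e1|[e1|[e1|[e1|[e1|[e1|e1]]]]]]]] : p = -4 \/ p = -3 \/ p = -2
   \/ p = -1 \/ p = 0 \/ p = 1 \/ p = 2 \/ p = 3 \/ p = 4 by lia.
all: rewrite e1 in h1 h2 h3 h4 d0 dc ca *; try (exfalso; lia).
all: try (constructor 1; split; [lia|done|done]).
all: try (constructor 2; split; [lia|done|done]).
all: constructor 3; first
  [ exists (0, 1); split; [lia|done|lia|done]
  | exists (0, -1); split; [lia|done|lia|done]
  | exists (1, -1); split; [lia|done|lia|done]
  | exists (-1, 1); split; [lia|done|lia|done] ].
Qed.

Lemma classified_unit_section a b c x y z : det2 a b c = 1 ->
    tdet a b c x y z = 1 ->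
    [\/ [/\ a = 1, b = 0 & c = 1],
        [/\ a = 2, c = 2 & b \in [:: om; - om; cj om; - cj om]] |
        exists b', [/\ a = 4, c = 4, det2 a b c = 4 & b = 2%:~R * b']] ->
  classified (tern a b c x y z).
Proof.
move=> d1 t1 cases; apply: classified_rep (tern_split d1 t1) _.
have diagN b' : rep (tern 2 b' 2 0 0 1) (tern 2 (- b') 2 0 0 1).
  exists (mxs 3 3 [:: [:: - 1; 0; 0]; [:: 0; 1; 0]; [:: 0; 0; 1]]).
  by mx_cases; conj_norm; ring.
have swapb : rep even_tern (tern 2 (cj om) 2 0 0 1).
  by have [] := tern_swap 2 (cj om) 2 0 0 1; rewrite cjK.
case: cases => [[-> -> ->]|[-> ->]|[b' []]]; last by lia.
  left; exists 1%:M; rewrite mul1mx /star trmx1 map_mx1 mulmx1 //.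
have refl T : rep T T by exists 1%:M; rewrite mul1mx /star trmx1 map_mx1 mulmx1.
rewrite !inE => /or4P[] /eqP->; right.
- exact: refl.
- exact: diagN.
- exact: swapb.
exact: rep_trans swapb (diagN _).
Qed.

Lemma tdet_even a b c x y z :
  tdet (2 * a) (2%:~R * b) (2 * c) x y z = 2 * (2 * z * det2 a b c - val2 a b c y (- x)).
Proof. by rewrite /tdet val2_scale /det2 nrmM nrm_int; ring. Qed.

(** Outer induction on the determinant of the section, inner one on its trace: a
    shear lowers the trace of a section that is not reduced, and tern_dual
    lowers the determinant to c if c is smaller. *)
Lemma ternary_classified a b c x y z :
  posb a b c -> tdet a b c x y z = 1 -> classified (tern a b c x y z).
Proof.
have [n] := ubnP `|det2 a b c|%N.
elim: n => // n IHn in a b c x y z *.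
have [m] := ubnP `|(a + c)%R|%N.
elim: m => // m IHm in a b c x y z *.
wlog ca : a b c x y z / c <= a.
  move=> H am dn pos t1; have [|ac] := leP c a; first by move=> ca; exact: H.
  have [r t] := tern_swap a b c x y z.
  apply: classified_rep r _; apply: H; rewrite ?posb_swap ?t //; first by lia.
    by move: am; rewrite addrC.
  by move: dn; rewrite /det2 nrm_cj mulrC.
move=> am dn pos t1; have /and3P[a0 c0 d0] := pos.
have [hex|/not_hexagon-/(_ c0)[s s0]] := boolP (hexagon c b); last first.
  have [r t] := tern_shear s a b c x y z.
  have [_ d] := shear s a b c.
  have ea : val2 a b c 1 s = a + (tr (b * cj s) + c * nrm s).
    by rewrite val2_def mul1r nrm1; ring.
  have a'0 : 0 < val2 a b c 1 s.
    move: d d0; rewrite /det2; have := nrm_ge0 (b + s * c%:~R).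
    by move: (val2 _ _ _ _ _) (nrm (b + _)) (nrm b) => u v w v0 e d0; nia.
  apply: classified_rep r _; apply: IHm; rewrite ?t ?d //; first by lia.
  by rewrite /posb a'0 c0 d.
have [cd|dc] := ltP c (det2 a b c).
  have [r t d] := tern_dual t1.
  apply: classified_rep r _; apply: IHn => //; first by rewrite d; lia.
  rewrite /posb d c0 d0 !andbT.
  move: d; rewrite {1}/det2; have := nrm_ge0 (b * y - x * c%:~R).
  move: (c * z - _) (nrm (_ - _)) => u v v0 e; nia.
have cases := reduced_section pos hex ca dc.
have d1 : det2 a b c = 1; last exact: classified_unit_section.
case: cases => [[-> -> ->]|[-> -> ]|[b' [ea ec _ eb]]].
- by rewrite /det2 nrm_def.
- by rewrite !inE => /or4P[] /eqP->; rewrite /det2 nrm_def.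
by move: t1; rewrite ea ec eb (_ : 4 = 2 * 2) // tdet_even; lia.
Qed.

(** * From sums of three squares to the quaternary lattice *)

Definition quat : 'M[OE]_4 :=
  mxs 4 4 [:: [:: 1; 0; 0; 0]; [:: 0; 1; 0; 0];
              [:: 0; 0; 2; om]; [:: 0; 0; cj om; 2]].

Lemma rep_even_tern_quat : rep quat even_tern.
Proof.
exists (mxs 3 4 [:: [:: 0; 0; 1; 0]; [:: 0; 0; 0; 1]; [:: 1; 0; 0; 0]]).
by mx_cases; rewrite ?cj_om; conj_norm; rewrite ?rmorph1 ?rmorph0; ring.
Qed.

Definition sumsq n (s : seq 'cV[OE]_n) : 'M_n := \sum_(v <- s) v *m star v.

Lemma sumsq_perm n (s t : seq 'cV[OE]_n) : perm_eq s t -> sumsq s = sumsq t.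
Proof. exact: perm_big. Qed.

Lemma starN m n (X : 'M_(m, n)) : star (- X) = - star X.
Proof. by rewrite /star linearN /= map_mxN. Qed.

Lemma sumsq_sign n (v : 'cV[OE]_n) s : sumsq (- v :: s) = sumsq (v :: s).
Proof. by rewrite /sumsq !big_cons starN mulmxN mulNmx opprK. Qed.

Lemma sumsq0 n (s : seq 'cV[OE]_n) : sumsq (0 :: s) = sumsq s.
Proof. by rewrite /sumsq big_cons mul0mx add0r. Qed.

Definition cols n (s : seq 'cV[OE]_n) : 'M_(n, 4) :=
  \matrix_(i, j) (nth 0 s j) i 0.

(** In <1,1> the vectors x with x_1 - x_2 divisible by omega have the basis
    (1, 1), (omega, 0), of Gram matrix (2, conj omega; omega, 3). The vectors
    f1 and (1 + omega) f1 + conj(omega) f2 of B have the same one. *)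
Lemma rep_quat_pair n (u v w t : 'cV[OE]_n) :
  rep quat (sumsq [:: v + om *: t; v; u; w]).
Proof.
exists (cols [:: u; w; v + (1 + om) *: t; cj om *: t]).
apply/matrixP => i j.
rewrite /sumsq !big_cons big_nil !(mxE, big_ord_recl, big_ord0) /=.
rewrite !cj_om; conj_norm; rewrite ?cj_om ?rmorph1 ?rmorph0.
by ring: om_sqr.
Qed.

(** In I_3 the vectors x with x_1 + x_2 + x_3 divisible by omega have the basis
    (1, 0, -1), (0, 1, -1), (0, 0, omega). With f0 the basis vector of <1>, the
    vectors (1 - omega) f1 - 2 f2, (1 - omega) f1 - f2 and
    - f0 - 2 f1 + omega f2 of <1> + B have the same Gram matrix. *)
Lemma rep_quat_triple n (u v t : 'cV[OE]_n) :
  rep quat (sumsq [:: u; v; om *: t - u - v]).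
Proof.
exists (cols [:: - t; 0; (1 - om) *: (u + v) - 2%:~R *: t; om *: t - u - (u + v)]).
apply/matrixP => i j.
rewrite /sumsq !big_cons big_nil !(mxE, big_ord_recl, big_ord0) /=.
rewrite !cj_om; conj_norm; rewrite ?cj_om ?rmorph1 ?rmorph0.
by ring: om_sqr.
Qed.

Definition div_om (u : OE) : OE := (u.2 + (u.1 %/ 3)%Z, - (u.1 %/ 3)%Z).

(** Modulo omega, p + q omega is p, and 3 = omega conj(omega). *)
Lemma om_dvd_col n (v : 'cV[OE]_n) :
  (forall i, (3 %| (v i 0%R).1)%Z) -> v = om *: \col_i div_om (v i 0).
Proof.
move=> dv; apply/matrixP => i j; rewrite !mxE (ord1 j).
have := dv i; case: (v i 0) => p q /= dp.
by apply: OE_eq => /=; have := divzK dp; lia.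
Qed.

(** Three vectors of the plane F_3^2 are linearly dependent, and the coefficients
    can be taken in {0, 1, -1}. *)
Lemma kernel_mod3 (v : 'I_3 -> 'cV[OE]_2) : exists e : 'I_3 -> int,
  [/\ forall k, e k \in [:: 0; 1; -1], exists k, e k != 0
    & exists t, \sum_k (e k)%:~R *: v k = om *: t].
Proof.
pose A : 'M['F_3]_(3, 2) := \matrix_(k, i) ((v k i 0).1)%:~R.
have /rowV0Pn[r /sub_kermxP rA r0] : kermx A != 0.
  rewrite kermx_eq0 /row_free neq_ltn; apply/orP; left.
  exact: leq_ltn_trans (rank_leq_col A) _.
pose e (x : 'F_3) : int := if x == 0 then 0 else if x == 1 then 1 else -1.
have eK x : (e x)%:~R = x.
  by case: x => -[|[|[|//]]] i; rewrite /e /=; apply/val_inj.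
exists (fun k => e (r 0 k)); split.
- by move=> k; rewrite /e; case: ifP; last case: ifP.
- have /rV0Pn[k rk] := r0; exists k.
  by apply: contraNneq rk => /(congr1 (fun n : int => n%:~R : 'F_3)); rewrite /= eK => ->.
eexists; apply: om_dvd_col => i.
rewrite (dvdz_pcharf (pchar_Fp (isT : prime 3))).
have := congr1 (fun M : 'rV_2 => M 0 i) rA; rewrite !mxE => rAi.
rewrite -[X in _ == X]rAi summxE; apply/eqP.
rewrite !big_ord_recl !big_ord0 !mxE /= !intrO /=.
by rewrite !mul0r !mulr0 !subr0 !addr0 !intrD !intrM !eK.
Qed.

Lemma rep_quat_sum3 (v1 v2 v3 : 'cV[OE]_2) : rep quat (sumsq [:: v1; v2; v3]).
Proof.
pose P v1 v2 v3 := rep quat (sumsq [:: v1; v2; v3] : 'M[OE]_2).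
have rot3 u v w : P v w u -> P u v w.
  by rewrite /P (@sumsq_perm _ [:: v; w; u] [:: u; v; w]) // (perm_rot 1 [:: u; v; w]).
have swap3 u v w : P v u w -> P u v w.
  rewrite /P (@sumsq_perm _ [:: v; u; w] [:: u; v; w]) //.
  exact/permPl/(perm_catCA [:: v] [:: u]).
have two v w t : P (v + om *: t) v w.
  have := rep_quat_pair w v 0 t.
  rewrite /P -(sumsq0 [:: _; v; w]) (@sumsq_perm _ [:: v + om *: t; v; w; 0] [:: 0; v + om *: t; v; w]) //.
  exact/permPl/(perm_rot 1 [:: 0; v + om *: t; v; w]).
have one v w t : P (om *: t) v w.
  have := rep_quat_pair v 0 w t; rewrite add0r.
  rewrite /P -(sumsq0 [:: _; v; w]) (@sumsq_perm _ [:: om *: t; 0; v; w] [:: 0; om *: t; v; w]) //.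
  exact/permPl/(perm_catCA [:: om *: t] [:: 0]).
have sgn u v w (e : int) : e \in [:: 0; 1; -1] -> e != 0 ->
    P (e%:~R *: u) v w -> P u v w.
  rewrite !inE => /or3P[]/eqP-> // _; first by rewrite scale1r.
  by rewrite scaleN1r /P sumsq_sign.
have lead u v w (i j k : int) t : i \in [:: 0; 1; -1] -> j \in [:: 0; 1; -1] ->
    k \in [:: 0; 1; -1] -> i != 0 ->
    i%:~R *: u + (j%:~R *: v + k%:~R *: w) = om *: t -> P u v w.
  move=> si sj sk i0 e; apply: (sgn _ _ _ i) => //.
  (* One, two or three of the coefficients are nonzero. *)
  move: (i%:~R *: u) e => {i0 si}u.
  have [->|j0] := eqVneq j 0; have [->|k0] := eqVneq k 0; rewrite ?scale0r ?add0r ?addr0.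
  - by move=> ->; exact: one.
  - move=> /(canRL (addrK _)) ->; apply/swap3/rot3/swap3.
    apply: (sgn _ _ _ k) => //; move: (k%:~R *: w) => {}w.
    by rewrite /P -sumsq_sign; apply: (swap3 _ _ _); rewrite addrC; exact: two.
  - move=> /(canRL (addrK _)) ->; apply: (swap3 _ _ _).
    apply: (sgn _ _ _ j) => //; move: (j%:~R *: v) => {}v.
    by rewrite /P -sumsq_sign; apply: (swap3 _ _ _); rewrite addrC; exact: two.
  move=> e; apply/rot3/(sgn _ _ _ j) => //; apply/rot3/(sgn _ _ _ k) => //; apply/rot3.
  have -> : k%:~R *: w = om *: t - u - j%:~R *: v by rewrite -e [_ - u]addrC addKr addrC addKr.
  exact: rep_quat_triple.
have [e [esgn [k ek] [t]]] := kernel_mod3 (fun k : 'I_3 => nth 0 [:: v1; v2; v3] k).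
rewrite !big_ord_recl big_ord0 addr0 /= => et.
have : [|| e ord0 != 0, e (lift ord0 ord0) != 0 | e (lift ord0 (lift ord0 ord0)) != 0].
  case: k ek => -[|[|[|//]]] i ek; apply/or3P; [constructor 1|constructor 2|constructor 3];
  by apply: contra ek => /eqP <-; apply/eqP; congr e; apply/val_inj.
case/or3P=> e0.
- exact: lead et.
- apply/rot3; apply: (lead _ _ _ _ _ _ t _ _ _ e0) => //; rewrite -et addrA addrC.
  exact.
- apply/rot3/rot3; apply: (lead _ _ _ _ _ _ t _ _ _ e0) => //; rewrite -et.
  by rewrite [RHS]addrA addrC.
Qed.

Lemma rep_id_tern_quat (N : 'M_2) : rep id_tern N -> rep quat N.
Proof.
move=> [X ->].
have -> : id_tern = 1%:M by mx_cases.
rewrite mulmx1; suff -> : X *m star X =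
    sumsq [:: col ord0 X; col (lift ord0 ord0) X; col (lift ord0 (lift ord0 ord0)) X].
  exact: rep_quat_sum3.
apply/matrixP => i j; rewrite /sumsq !big_cons big_nil !(mxE, big_ord_recl, big_ord0).
by rewrite !addr0.
Qed.

Lemma rep_quat_bin a b c : posb a b c -> rep quat (bin a b c).
Proof.
move=> pos; have [a' [b' [c' [x [y [z [p' t' r']]]]]]] := unimodular_ternary pos.
case: (ternary_classified p' t') => r; last first.
  by apply: rep_trans rep_even_tern_quat _; exact: rep_trans r r'.
by apply: rep_id_tern_quat; exact: rep_trans r r'.
Qed.

(** * Lattices over the algebraic numbers *)

Definition emb (u : OE) : algC := u.1%:~R + u.2%:~R * omega.

Fact emb_zmod : zmod_morphism emb.
Proof. by move=> u v; rewrite /emb /= !intrB; ring. Qed.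
Fact emb_mul : monoid_morphism emb.
Proof.
split=> [|u v]; first by rewrite /emb /= mul0r addr0.
rewrite /emb /= !(intrB, intrD, intrM).
by ring: omega_sqr.
Qed.
HB.instance Definition _ := GRing.isZmodMorphism.Build OE algC emb emb_zmod.
HB.instance Definition _ := GRing.isMonoidMorphism.Build OE algC emb emb_mul.

Lemma conj_omega : omega^* = 1 - omega.
Proof.
pose s := sqrtC (- 11 : algC); have s2 : s ^+ 2 = - 11 by rewrite sqrtCK.
suff sc : s^* = - s.
  by rewrite /omega rmorphM fmorphV rmorphD rmorph1 rmorph_nat -/s /= sc; field; rewrite ?pnatr_eq0.
have : s^* ^+ 2 = s ^+ 2 by rewrite -rmorphXn /= s2 rmorphN rmorph_nat.
move/eqP; rewrite eqf_sqr => /orP[/eqP/CrealP sR|/eqP//].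
have := real_exprn_even_ge0 sR (isT : ~~ odd 2).
by rewrite s2 oppr_ge0 lern0.
Qed.

Lemma emb_cj u : emb (cj u) = (emb u)^*.
Proof.
rewrite /emb /cj /= intrD mulrNz [RHS]rmorphD /= rmorphM /= !rmorph_int conj_omega; ring.
Qed.

Lemma in_OP z : in_O z <-> exists u, z = emb u.
Proof.
by split=> [[a [b ->]]|[[a b] ->]]; [exists (a, b)|exists a, b].
Qed.

Lemma rep_represents m n (M : 'M_m) (N : 'M_n) :
  rep M N -> represents (map_mx emb M) (map_mx emb N).
Proof.
move=> [X ->]; exists (map_mx emb X); split=> [i j|].
  by rewrite mxE; apply/in_OP; eexists.
rewrite !map_mxM /=; congr (_ *m _).
by apply/matrixP => i j; rewrite !mxE emb_cj.
Qed.

Lemma omega_im_neq0 : omega - omega^* != 0.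
Proof.
rewrite conj_omega; apply: contraTneq (ltr01 : 0 < 1 :> algC) => e.
have : 11 = (omega - (1 - omega)) ^+ 2 * (- 1) :> algC by ring: omega_sqr.
by rewrite e expr0n mul0r => /eqP; rewrite pnatr_eq0.
Qed.

Lemma emb_gt0 u : 0 < emb u -> exists2 a : int, 0 < a & u = a%:~R.
Proof.
move=> u0; have : (emb u)^* = emb u by apply/CrealP/gtr0_real.
case: u u0 => a b; rewrite /emb /= rmorphD rmorphM !rmorph_int => u0 e.
have : b%:~R * (omega - omega^*) = 0.
  by rewrite mulrBr; apply/eqP; rewrite subr_eq0; apply/eqP/(addrI a%:~R).
move/eqP; rewrite mulf_eq0 (negPf omega_im_neq0) orbF intr_eq0 => /eqP b0.
exists a; last by rewrite intrO b0.
by move: u0; rewrite b0 mul0r addr0 ltr0z.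
Qed.

Lemma emb_int (n : int) : emb n%:~R = n%:~R. Proof. exact: rmorph_int. Qed.

Lemma hermsym_conj n (N : 'M[algC]_n) i j : N \is hermsymmx -> N j i = (N i j)^*.
Proof.
by move=> /is_hermitianmxP/(congr1 (fun M : 'M_n => M j i)); rewrite !mxE expr0 mul1r.
Qed.

Lemma mx_in_O_emb m n (A : 'M[OE]_(m, n)) : mx_in_O (map_mx emb A).
Proof. by move=> i j; rewrite mxE; apply/in_OP; eexists. Qed.

Lemma emb_eq0 u : emb u = 0 -> u = 0.
Proof.
move=> u0; have : emb (nrm u)%:~R = 0 by rewrite nrmE rmorphM /= u0 mul0r.
move/eqP; rewrite emb_int intr_eq0 nrm_def => /eqP n0.
by apply: OE_eq => /=; nia.
Qed.

Lemma positive_lattice_bin N : positive_lattice N ->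
  exists a b c, posb a b c /\ N = map_mx emb (bin a b c).
Proof.
move=> [[hN oN] pN].
have val x y : (x != 0) || (y != 0) -> 0 < emb x * N 0 0 * emb (cj x)
   + emb x * N 0 1 * emb (cj y) + emb y * N 1 0 * emb (cj x)
   + emb y * N 1 1 * emb (cj y).
  move=> nz; pose v : 'rV[OE]_2 := \row_i (if i == 0 then x else y).
  have nzv : map_mx emb v != 0.
    apply: contraTneq nz => /matrixP v0; rewrite negb_or !negbK.
    by apply/andP; split; apply/eqP/emb_eq0; [have := v0 0 0|have := v0 0 1];
      rewrite !mxE.
  have := pN _ (mx_in_O_emb v) nzv.
  rewrite /herm_form !(mxE, big_ord_recl, big_ord0) /= -!emb_cj !addr0.
  have -> : lift ord0 ord0 = 1 :> 'I_2 by apply/val_inj.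
  set E := (X in 0 < X); suff -> : E = emb x * N 0 0 * emb (cj x)
   + emb x * N 0 1 * emb (cj y) + emb y * N 1 0 * emb (cj x)
   + emb y * N 1 1 * emb (cj y) by [].
  by rewrite /E; ring.
have [u00 N00] : exists u, N 0 0 = emb u by apply/in_OP.
have [u11 N11] : exists u, N 1 1 = emb u by apply/in_OP.
have [b N01] : exists u, N 0 1 = emb u by apply/in_OP.
have N10 : N 1 0 = emb (cj b) by rewrite emb_cj -N01; exact: hermsym_conj.
have [|a a0 ea] := @emb_gt0 u00.
  have := val 1 0 isT; rewrite !rmorph1 !rmorph0 N00.
  by rewrite !(mulr0, mul0r, mul1r, mulr1, addr0).
have [|c c0 ec] := @emb_gt0 u11.
  have := val 0 1 isT; rewrite !rmorph1 !rmorph0 N11.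
  by rewrite !(mulr0, mul0r, mul1r, mulr1, add0r).
exists a, b, c; split; last first.
  apply/matrixP => -[[|[|//]] i] -[[|[|//]] j]; rewrite !mxE /=.
  - by rewrite -ea -N00; congr (N _ _); apply/val_inj.
  - by rewrite -N01; congr (N _ _); apply/val_inj.
  - by rewrite -N10; congr (N _ _); apply/val_inj.
  - by rewrite -ec -N11; congr (N _ _); apply/val_inj.
rewrite /posb a0 c0 /=.
(* The vector -conj(b) e1 + a e2 is orthogonal to e1 and has norm a det2 a b c. *)
have /val : (- cj b != 0) || (a%:~R != 0 :> OE).
  apply/orP; right; rewrite intrO; apply: contraTneq a0 => -[->].
  by rewrite ltxx.
rewrite N00 N01 N10 N11 ea ec.
move=> h; suff : 0 < emb (a * det2 a b c)%:~R.
  by rewrite emb_int ltr0z pmulr_rgt0.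
have -> : (a * det2 a b c)%:~R = - cj b * a%:~R * cj (- cj b)
    + - cj b * b * cj a%:~R + a%:~R * cj b * cj (- cj b)
    + a%:~R * c%:~R * cj a%:~R.
  by rewrite /det2 intrM intrB intrM nrmE; conj_norm; ring.
by rewrite !(rmorphD emb) !(rmorphM emb).
Qed.

Lemma quat_positive : positive_lattice (map_mx emb quat).
Proof.
split; first split.
- apply/is_hermitianmxP; rewrite expr0 scale1r.
  apply/matrixP => i j; rewrite !mxE -emb_cj; congr emb.
  by case: i j => -[|[|[|[|//]]]] ? -[[|[|[|[|//]]]] ?] /=;
    rewrite ?cjK ?rmorph1 ?rmorph0 // rmorph_nat.
- exact: mx_in_O_emb.
move=> v _; rewrite /herm_form !(mxE, big_ord_recl, big_ord0) /=.
set v0 := v 0 _; set v1 := v 0 (lift _ _); set v2 := v 0 (lift _ (lift _ _)).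
set v3 := v 0 _ => nz.
rewrite emb_cj !rmorph1 !rmorph0 !rmorph_nat /=.
have -> : emb om = omega by rewrite /emb /= add0r mul1r.
set H := (X in 0 < X).
(* Completing the square in B, whose determinant is 1. *)
have -> : H = `|v0| ^+ 2 + (`|v1| ^+ 2
    + ((`|2 * v2 + omega^* * v3| ^+ 2 + `|v3| ^+ 2) / 2)).
  have conj_comb : (2 * v2 + omega^* * v3)^* = 2 * v2^* + omega * v3^*.
    by rewrite rmorphD [_ (2 * v2)]rmorphM [_ (_ * v3)]rmorphM /= conjCK rmorph_nat.
  rewrite !normCK conj_comb /H conj_omega.
  have e : omega * omega = omega - 3 by rewrite -omega_sqr.
  by field: e.
have nn (z : algC) : 0 <= `|z| ^+ 2 by rewrite exprn_ge0.
rewrite lt_def; apply/andP; split; last first.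
  by rewrite !addr_ge0 // divr_ge0 ?addr_ge0 // ler0n.
apply: contra nz.
rewrite !paddr_eq0 ?addr_ge0 ?divr_ge0 ?addr_ge0 ?ler0n //.
rewrite [_ / 2 == 0]mulf_eq0 invr_eq0 pnatr_eq0 orbF paddr_eq0 // !sqrf_eq0 !normr_eq0.
move=> /and4P[/eqP e0 /eqP e1 e2 /eqP e3].
move: e2; rewrite e3 mulr0 addr0 mulf_eq0 pnatr_eq0 => /eqP e2.
apply/eqP/matrixP => i j; rewrite !mxE (ord1 i).
by case: j => -[|[|[|[|//]]]] ?; [rewrite -e0|rewrite -e1|rewrite -e2|rewrite -e3];
  congr (v _ _); apply/val_inj.
Qed.

Lemma quatE :
  orth_sum (diag_lattice [tuple 1; 1]) (mx22 2 omega omega^* 2) = map_mx emb quat.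
Proof.
rewrite -[RHS](@submxK _ 2 2 2 2) /orth_sum; congr block_mx;
  apply/matrixP => -[[|[|?]] ?] -[[|[|?]] ?] //; rewrite !mxE /= ?mxE /= ?emb_cj;
  rewrite ?rmorph0 ?rmorph1 ?rmorph_nat ?(tnth_nth 0) //=.
- by rewrite /emb /= add0r mul1r.
by rewrite /emb /= add0r mul1r.
Qed.

Theorem theorem7 :
  two_universal
    (orth_sum (diag_lattice [tuple 1; 1]) (mx22 2 omega omega^* 2)).
Proof.
rewrite quatE; split; first exact: quat_positive.
move=> N /positive_lattice_bin[a [b [c [pos ->]]]].
exact/rep_represents/rep_quat_bin.
Qed.
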